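(* For every conditional relation $R$ we have $u(f_C(R))\subseteq f_C(R)$. Consequently $u(f_C(R))\subseteq f_C(u(R))$ for all conditional relations $R$, i.e. $u$ is $f_C$-compatible.
   Context: Composition of $f\colon A\to B$, $g\colon B\to C$ is written $f;g$. Fix a category $\mathbf C$ with distinguished object $0$ and a representative class $\kappa$ of commuting squares: for every commuting square $\alpha_1;\delta_1=\alpha_2;\delta_2$ there are $(\alpha_1,\alpha_2,\beta_1,\beta_2)\in\kappa$ (a commuting square) and $\gamma$ with $\delta_1=\beta_1;\gamma$, $\delta_2=\beta_2;\gamma$; $\kappa(\alpha_1,\alpha_2)$ is the set of $(\beta_1,\beta_2)$ with $(\alpha_1,\alpha_2,\beta_1,\beta_2)\in\kappa$. Conditions over $A$ are defined inductively as $(A,\mathcal Q,S)$, $\mathcal Q\in\{\forall,\exists\}$, $S$ a finite set of pairs $(h,\mathcal A')$ with $h\colon A\to A'$, $\mathcal A'$ a condition over $A'$. For $a\colon A\to B$: $a\models(A,\forall,S)$ iff for all $(h,\mathcal A')\in S$ and all $g$ with $a=h;g$, $g\models\mathcal A'$; $a\models(A,\exists,S)$ iff some $(h,\mathcal A')\in S$ and $g$ satisfy $a=h;g$, $g\models\mathcal A'$. $\mathcal A\models\mathcal B$: every arrow satisfying $\mathcal A$ satisfies $\mathcal B$. Boolean connectives have the standard semantics. Shift along $c\colon A\to B$: $(A,\mathcal Q,S)_{\downarrow c}=(B,\mathcal Q,\{(\beta,\mathcal A'_{\downarrow\alpha})\mid(h,\mathcal A')\in S,(\alpha,\beta)\in\kappa(h,c)\})$;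 it satisfies $c;d\models\mathcal A\iff d\models\mathcal A_{\downarrow c}$. A conditional reactive system is a set $\mathcal S$ of rules $(\ell,r,\mathcal R)$, $\ell,r\colon0\to I$, $\mathcal R$ a condition over $I$. Context step $a\xrightarrow[C]{f,\ \mathcal A}a'$ ($a\colon0\to J$, $f\colon J\to K$, $a'\colon0\to K$, $\mathcal A$ over $K$): there are a rule $(\ell,r,\mathcal R)\in\mathcal S$ and $c\colon I\to K$ with $a;f=\ell;c$, $a'=r;c$, $\mathcal A\models\mathcal R_{\downarrow c}$. A conditional relation is a set of triples $(a,b,\mathcal C)$, $a,b\colon0\to J$, $\mathcal C$ a condition over $J$. $\mathcal D\models\bigvee_{i\in I}\mathcal E_i$ (possibly infinite $I$): every arrow satisfying $\mathcal D$ satisfies some $\mathcal E_i$. The closure under contextualization is $u(R)=\{(a;d,\ b;d,\ \mathcal C_{\downarrow d})\mid(a,b,\mathcal C)\in R,\ a,b\colon0\to J,\ d\colon J\to K\}$. The function $f_C$ maps a conditional relation $R$ to the set of triples $(a,b,\mathcal C)$ such that for each context step $a\xrightarrow[C]{f,\ \mathcal A}a'$ there are an index set $I$, context steps $b\xrightarrow[C]{f,\ \mathcal B_i}b'_i$ and conditions $\mathcal C'_i$ with $(a',b'_i,\mathcal C'_i)\in R$ and $\mathcal A\land\mathcal C_{\downarrow f}\models\bigvee_{i\in I}(\mathcal C'_i\land\mathcal B_i)$, and symmetrically each context step $b\xrightarrow[C]{f,\ \mathcal B}b'$ is answered by context steps $a\xrightarrow[C]{f,\ \mathcal A_j}a'_j$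 with $(a'_j,b',\mathcal C'_j)\in R$ and $\mathcal B\land\mathcal C_{\downarrow f}\models\bigvee_j(\mathcal C'_j\land\mathcal A_j)$. *)

(* Defs.v *)
From Stdlib Require List.
From mathcomp Require Import all_boot finmap.
From mathcomp Require Import boolp classical_sets cardinality.
Set Implicit Arguments.
Unset Strict Implicit.
Unset Printing Implicit Defensive.

Local Open Scope classical_set_scope.

Record category := Category {
  obj :> Type;
  hom : obj -> obj -> Type;
  idm : forall A, hom A A;
  compose : forall A B D, hom A B -> hom B D -> hom A D;
  idm_compose : forall A B (f : hom A B), compose (idm A) f = f;
  compose_idm : forall A B (f : hom A B), compose f (idm B) = f;
  composeA : forall A B D E (f : hom A B) (g : hom B D) (h : hom D E),
    compose f (compose g h) = compose (compose f g) h }.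

Arguments hom {c} A B.
Arguments idm {c} A.
Arguments compose {c A B D} f g.

(* Diagrammatic order: first [f], then [g]. *)
Notation "f ;; g" := (compose f g) (at level 40, left associativity).

Record cospan (C : category) (B1 B2 : C) := Cospan {
  apex : C;
  leg1 : hom B1 apex;
  leg2 : hom B2 apex }.

Arguments leg1 {C B1 B2} _.
Arguments leg2 {C B1 B2} _.

(* [kappa a1 a2 (Cospan b1 b2)] means that the square (a1, a2, b1, b2) belongs
   to the class.  Finiteness of [kappa a1 a2] is what makes the shift of a
   (finite) condition a condition again. *)
Record rep_class (C : category) := RepClass {
  kappa : forall A B1 B2 : C, hom A B1 -> hom A B2 -> set (cospan B1 B2);
  kappa_commutes : forall (A B1 B2 : C) (a1 : hom A B1) (a2 : hom A B2) s,
    kappa a1 a2 s -> a1 ;; leg1 s = a2 ;; leg2 s;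
  kappa_represents : forall (A B1 B2 D : C) (a1 : hom A B1) (a2 : hom A B2)
      (d1 : hom B1 D) (d2 : hom B2 D),
    a1 ;; d1 = a2 ;; d2 ->
    exists2 s, kappa a1 a2 s &
      exists g : hom (apex s) D, d1 = leg1 s ;; g /\ d2 = leg2 s ;; g;
  kappa_finite : forall (A B1 B2 : C) (a1 : hom A B1) (a2 : hom A B2),
    finite_set (kappa a1 a2) }.

Arguments kappa {C} r {A B1 B2} a1 a2.

(* Enumeration of the finite set [kappa k a1 a2]; [{classic T}] only equips [T]
   with the choice structure required by [fset_set]. *)
Definition kappa_seq (C : category) (k : rep_class C) (A B1 B2 : C)
    (a1 : hom A B1) (a2 : hom A B2) : seq (cospan B1 B2) :=
  fset_set (kappa k a1 a2 : set {classic cospan B1 B2}).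

Inductive quantifier := Forall | Exists.

(* The finite set of pairs (h, A') is given by a list. *)
Inductive cond (C : category) (A : C) : Type :=
  Cond of quantifier & seq {A' : C & (hom A A' * cond A')%type}.

Definition branch (C : category) (A : C) : Type :=
  {A' : C & (hom A A' * cond A')%type}.

Definition Branch (C : category) (A A' : C) (h : hom A A') (c : cond A') :
    branch A :=
  existT _ A' (h, c).

(* Least solution of the recursive clauses, hence the only one, conditions
   being well-founded. *)
Inductive sat (C : category) :
    forall A : C, cond A -> forall B : C, hom A B -> Prop :=
| sat_Forall (A : C) (S : seq (branch A)) (B : C) (a : hom A B) :
    (forall (A' : C) (h : hom A A') (c : cond A'), List.In (Branch h c) S ->
       forall g : hom A' B, a = h ;; g -> sat c g) ->
    sat (Cond Forall S) a
| sat_Exists (A : C) (S : seq (branch A)) (B : C) (a : hom A B)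
    (A' : C) (h : hom A A') (c : cond A') (g : hom A' B) :
    List.In (Branch h c) S -> a = h ;; g -> sat c g ->
    sat (Cond Exists S) a.

Fixpoint shift (C : category) (k : rep_class C) (A : C) (c : cond A) (B : C)
    (f : hom A B) {struct c} : cond B :=
  let: Cond q s := c in
  Cond q (flatten [seq
    (let: existT A' (h, c') := p in
     [seq Branch (leg2 t) (shift k c' (leg1 t)) | t <- kappa_seq k h f])
    | p <- s]).

(* Classes of arrows with domain [A], the semantic values of (possibly
   infinitary) Boolean combinations of conditions; [sat c] is the class of
   arrows satisfying [c]. *)
Definition arrows (C : category) (A : C) := forall B : C, hom A B -> Prop.

Definition arr_and (C : category) (A : C) (P Q : arrows A) : arrows A :=
  fun B a => P B a /\ Q B a.

Definition arr_or (C : category) (A : C) (I : Type) (P : I -> arrows A) :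
    arrows A :=
  fun B a => exists i, P i B a.

Definition entails (C : category) (A : C) (P Q : arrows A) : Prop :=
  forall (B : C) (a : hom A B), P B a -> Q B a.

Section ReactiveSystems.

Variables (C : category) (zero : C) (k : rep_class C).

Record rule := Rule {
  interface : C;
  lhs : hom zero interface;
  rhs : hom zero interface;
  rcond : cond interface }.

Definition context_step (S : set rule) (J K : C) (a : hom zero J)
    (f : hom J K) (A : cond K) (a' : hom zero K) : Prop :=
  exists2 r : rule, S r &
    exists c : hom (interface r) K,
      [/\ a ;; f = lhs r ;; c, a' = rhs r ;; c &
          entails (sat A) (sat (shift k (rcond r) c))].

Definition cond_relation :=
  forall J : C, set (hom zero J * hom zero J * cond J).

Definition subrelation (R R' : cond_relation) : Prop :=
  forall J : C, R J `<=` R' J.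

Definition ctx_closure (R : cond_relation) : cond_relation := fun K =>
  [set t | exists (J : C) (a b : hom zero J) (c : cond J) (d : hom J K),
     R J (a, b, c) /\ t = (a ;; d, b ;; d, shift k c d)].

Definition fC (S : set rule) (R : cond_relation) : cond_relation := fun J =>
  [set t | let: (a, b, c) := t in
    (forall (K : C) (f : hom J K) (A : cond K) (a' : hom zero K),
       context_step S a f A a' ->
       exists (I : Type) (B : I -> cond K) (b' : I -> hom zero K)
              (c' : I -> cond K),
         [/\ forall i, context_step S b f (B i) (b' i),
             forall i, R K (a', b' i, c' i) &
             entails (arr_and (sat A) (sat (shift k c f)))
                     (arr_or (fun i => arr_and (sat (c' i)) (sat (B i))))]) /\
    (forall (K : C) (f : hom J K) (B : cond K) (b' : hom zero K),
       context_step S b f B b' ->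
       exists (I : Type) (A : I -> cond K) (a' : I -> hom zero K)
              (c' : I -> cond K),
         [/\ forall i, context_step S a f (A i) (a' i),
             forall i, R K (a' i, b', c' i) &
             entails (arr_and (sat B) (sat (shift k c f)))
                     (arr_or (fun i => arr_and (sat (c' i)) (sat (A i))))])].

Definition compatible (f u : cond_relation -> cond_relation) : Prop :=
  forall R : cond_relation, subrelation (u (f R)) (f (u R)).

End ReactiveSystems.

(* Main.v *)
(** A step of [a ;; d] in context [f] is a step of [a] in context [d ;; f], and
    by the shift property [shift k (shift k c d) f] and [shift k c (d ;; f)] are
    satisfied by the same arrows.  Hence the answers required for the
    contextualized triple are the answers of the original one, and the reached
    triples stay in [R] without any further contextualization. *)
Require Import Defs.
From Stdlib Require List.
From mathcomp Require Import all_boot finmap.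
From mathcomp Require Import boolp classical_sets cardinality.
Set Implicit Arguments.
Unset Strict Implicit.
Unset Printing Implicit Defensive.

Local Open Scope classical_set_scope.

Lemma In_mem (T : eqType) (x : T) (s : seq T) : List.In x s <-> x \in s.
Proof.
elim: s => [|y s IHs] //=; rewrite inE IHs.
by split=> [[->|->]|/orP[/eqP ->|]]; rewrite ?eqxx ?orbT; auto.
Qed.

Lemma In_flatten_map (T U : Type) (F : T -> seq U) (s : seq T) (y : U) :
  List.In y (flatten (map F s)) <-> exists2 x, List.In x s & List.In y (F x).
Proof.
elim: s => [|x s IHs] /=; first by split=> // -[].
rewrite List.in_app_iff IHs; split=> [[yFx|[z zs yFz]]|[z [<-|zs] yFz]].
- by exists x; first left.
- by exists z; first right.
- by left.
- by right; exists z.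
Qed.

Section Conditions.

Variables (C : category) (k : rep_class C).

Lemma In_kappa_seq (A B1 B2 : C) (a1 : hom A B1) (a2 : hom A B2)
    (t : cospan B1 B2) :
  List.In t (kappa_seq k a1 a2) <-> kappa k a1 a2 t.
Proof.
rewrite (@In_mem {classic cospan B1 B2}) in_fset_set.
  by rewrite inE.
(* [fset_set] is faithful only on finite sets. *)
exact: kappa_finite.
Qed.

(** Conditions recur inside a list of pairs, where the generated induction principle gives no
    hypothesis; an inner induction on the list supplies one for each branch. *)
Lemma cond_nested_ind (P : forall A : C, cond A -> Prop) :
  (forall (A : C) (q : quantifier) (S : seq (branch A)),
     (forall p, List.In p S -> P _ (projT2 p).2) -> P A (Cond q S)) ->
  forall (A : C) (c : cond A), P A c.
Proof.
move=> IH; fix rec 2 => A [q S]; apply: IH.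
elim: S => [|[A' [h c]] S IHS] p; first by case.
case=> [<-|pS]; [exact: rec | exact: IHS].
Qed.

(* Branches are kept as pairs and projected, so that unfolding a
   satisfaction never requires inverting an equality of dependent pairs. *)
Lemma satE (A : C) (c : cond A) (B : C) (a : hom A B) :
  sat c a <->
  match c with
  | Cond Forall s => forall p, List.In p s ->
      forall g : hom (projT1 p) B, a = (projT2 p).1 ;; g -> sat (projT2 p).2 g
  | Cond Exists s => exists2 p, List.In p s &
      exists2 g : hom (projT1 p) B, a = (projT2 p).1 ;; g & sat (projT2 p).2 g
  end.
Proof.
split.
  case=> {A c B a} [A S B a satS [A' [h c']] hS g|A S B a A' h c' g hS ag cg] /=.
    exact: satS.
  by exists (Branch h c') => //; exists g.
case: c => -[] S; first by move=> satS; constructor => A' h c' /satS.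
by case=> -[A' [h c']] hS [g ag cg]; apply: sat_Exists hS ag cg.
Qed.

(** The list is spelled out as the body of [shift], the form met after unfolding [sat] of a shifted
    condition. *)
Lemma In_shift (A B : C) (f : hom A B) (S : seq (branch A)) (p' : branch B) :
  List.In p' (flatten [seq
    (let: existT A' (h, c') := p in
     [seq Branch (leg2 t) (shift k c' (leg1 t)) | t <- kappa_seq k h f])
    | p <- S]) <->
  exists2 p, List.In p S & exists2 t, kappa k (projT2 p).1 f t &
    p' = Branch (leg2 t) (shift k (projT2 p).2 (leg1 t)).
Proof.
rewrite In_flatten_map.
split=> -[[A' [h c]] hS /=].
  move=> /List.in_map_iff [t [<- /In_kappa_seq tk]].
  by exists (existT _ A' (h, c)) => //; exists t.
move=> [t tk ->]; exists (existT _ A' (h, c)) => //.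
by apply/List.in_map_iff; exists t; split=> //; apply/In_kappa_seq.
Qed.

(** Representativity turns a factorization [f ;; g = h ;; e] into one of [g] through a leg of a
    square in [kappa]; commutation of that square leads back. *)
Lemma sat_shift (A : C) (c : cond A) (B D : C) (f : hom A B) (g : hom B D) :
  sat (shift k c f) g <-> sat c (f ;; g).
Proof.
(* Both arrows are generalized: on a branch, [leg1 t] takes the place of [f]. *)
elim/cond_nested_ind: c B D f g => {}A q S IH B D f g.
rewrite !satE /=; case: q; split.
- move=> satS p pS e fge.
  have [t tk [m [-> gE]]] := kappa_represents k (esym fge).
  apply/(IH p pS).
  apply: (satS (Branch (leg2 t) (shift k (projT2 p).2 (leg1 t))) _ m gE).
  by apply/In_shift; exists p => //; exists t.
- move=> satS _ /In_shift [p pS [t tk ->]] /= e gE.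
  apply/(IH p pS); apply: satS => //.
  by rewrite gE !composeA (kappa_commutes tk).
- move=> [_ /In_shift [p pS [t tk ->]] /= [e -> pe]].
  exists p => //; exists (leg1 t ;; e); last exact/(IH p pS).
  by rewrite !composeA (kappa_commutes tk).
- move=> [p pS [e fge pe]].
  have [t tk [m [eE gE]]] := kappa_represents k (esym fge).
  exists (Branch (leg2 t) (shift k (projT2 p).2 (leg1 t))).
    by apply/In_shift; exists p => //; exists t.
  by exists m => //; apply/(IH p pS); rewrite -eE.
Qed.

Lemma sat_shift_idm (A : C) (c : cond A) (B : C) (a : hom A B) :
  sat (shift k c (idm A)) a <-> sat c a.
Proof. by rewrite sat_shift idm_compose. Qed.

Lemma sat_shift_compose (A B D E : C) (c : cond A) (d : hom A B) (f : hom B D)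
    (a : hom D E) :
  sat (shift k (shift k c d) f) a <-> sat (shift k c (d ;; f)) a.
Proof. by rewrite !sat_shift composeA. Qed.

End Conditions.

Section Compatibility.

Variables (C : category) (zero : C) (k : rep_class C) (S : set (rule zero)).

Lemma context_step_compose (J J' K : C) (a : hom zero J) (d : hom J J')
    (f : hom J' K) (A : cond K) (a' : hom zero K) :
  context_step k S (a ;; d) f A a' <-> context_step k S a (d ;; f) A a'.
Proof. by rewrite /context_step composeA. Qed.

Lemma ctx_closure_fC (R : cond_relation zero) :
  subrelation (ctx_closure k (fC k S R)) (fC k S R).
Proof.
move=> J' _ [J [a [b [c [d [[fwd bwd] ->]]]]]].
split=> K f A a' /context_step_compose.
  move=> /fwd [I [B [b' [c' [stepB R' ent]]]]]; exists I, B, b', c'.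
  split=> // [i|D e [Ae /sat_shift_compose ce]]; last exact: ent.
  exact/context_step_compose.
move=> /bwd [I [B [b' [c' [stepB R' ent]]]]]; exists I, B, b', c'.
split=> // [i|D e [Ae /sat_shift_compose ce]]; last exact: ent.
exact/context_step_compose.
Qed.

(* [R] itself need not be contained in [ctx_closure k R], since [shift k c (idm _)]
   is only semantically equivalent to [c]; after [fC] this suffices. *)
Lemma fC_ctx_closure (R : cond_relation zero) :
  subrelation (fC k S R) (fC k S (ctx_closure k R)).
Proof.
have R_idm K a b c : R K (a, b, c) ->
    ctx_closure k R (a, b, shift k c (idm K)).
  by move=> Rabc; exists K, a, b, c, (idm K); rewrite !compose_idm.
move=> J [[a b] c] [fwd bwd].
split=> K f A a' => [/fwd|/bwd] [I [B [b' [c' [stepB R' ent]]]]];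
  (* The answering steps are unchanged, and the same index [i] witnesses the disjunction. *)
  exists I, B, b', (fun i => shift k (c' i) (idm K)); split=> // [i|D e /ent];
  try exact: R_idm;
  by case=> i [ci Bi]; exists i; split=> //; apply/sat_shift_idm.
Qed.

End Compatibility.

Theorem theorem5p9 (C : category) (zero : C) (k : rep_class C)
    (S : set (rule zero)) :
  (forall R : cond_relation zero,
     subrelation (ctx_closure k (fC k S R)) (fC k S R)) /\
  compatible (fC k S) (ctx_closure (zero := zero) k).
Proof.
(* Compatibility passes through [fC k S R], the middle term of the two inclusions. *)
split=> [|R J t /ctx_closure_fC]; first exact: ctx_closure_fC.
exact: fC_ctx_closure.
Qed.
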